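(* Let $\mu,\mu_{\mathrm{eff}},K_B,K_D,\alpha>0$ be constants, let $y_{BD}=0.9$, $y_{SB}=1.1$, $h_B=y_{SB}-y_{BD}$, $e_y=(0,1)^T$, and let $c\in\mathbb R$. For a smooth state $z=(u_{\mathrm S},p_{\mathrm S},\sigma_{\mathrm S},a_{\mathrm S},u_{\mathrm B},p_{\mathrm B},\sigma_{\mathrm B},a_{\mathrm B},q_D,p_D)$ let $z+\delta z$ be the state obtained by leaving $u_{\mathrm S},u_{\mathrm B},a_{\mathrm S},q_D,p_D$ unchanged and adding $$\delta p_{\mathrm B}=c(y-y_{BD}),\qquad \delta p_{\mathrm S}=c\,h_B,\qquad \delta\sigma_r=-\delta p_r I\ (r\in\{\mathrm S,\mathrm B\}),\qquad \delta a_{\mathrm B}=c\,e_y .$$ Then, with residuals, functional $\mathcal J$ and moment $M_B$ as defined in the context: (i) for every smooth state $z$, the interface, constitutive and auxiliary residuals, and all other residuals except Brinkman momentum, are the same at $z+\delta z$ as at $z$, while $\mathcal R_{\mathrm B}^m(z+\delta z)=\mathcal R_{\mathrm B}^m(z)+c\,e_y$; (ii) if $z$ is a sufficiently smooth exact solution of the coupled problem with $a_r=\nabla p_r$ (so that all residuals vanish), then $$\mathcal J(z+\delta z)=\frac{c^2}{2(1+\mu/K_B)^2};$$ (iii) for every smooth state $z$, $M_B(z+\delta z)=M_B(z)+c$. (iv) The traction residual at the Brinkman--Darcy interface and the traction jump $\sigma_{\mathrm S}n-\sigma_{\mathrm B}n$ at the Stokes--Brinkman interface are unchanged both when computed with $\sigma_r$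 and when computed with the reconstructed stress $\mu_r\nabla u_r-p_rI$ in place of $\sigma_r$.
   Context: Geometry: $\Omega_{\mathrm D}=(0,1)\times(0,0.9)$, $\Omega_{\mathrm B}=(0,1)\times(0.9,1.1)$, $\Omega_{\mathrm S}=(0,1)\times(1.1,2)$; $\Gamma_{\mathrm{SB}}=\{(x,1.1):0<x<1\}$, $\Gamma_{\mathrm{BD}}=\{(x,0.9):0<x<1\}$; $\Gamma_r^{\mathrm{ext}}=\partial\Omega_r\cap\partial\Omega$ with $\Omega=(0,1)\times(0,2)$. Constants: $\mu_{\mathrm S}=\mu$, $\mu_{\mathrm B}=\mu_{\mathrm{eff}}$, $\lambda_{\mathrm{BJS}}=\alpha\mu_{\mathrm{eff}}/\sqrt{K_D}$, $\chi_{\mathrm S}=0$, $\chi_{\mathrm B}=1$, $n=(0,-1)^T$, $t=(1,0)^T$. A state consists of $u_r:\Omega_r\to\mathbb R^2$, $p_r:\Omega_r\to\mathbb R$, $\sigma_r:\Omega_r\to\mathbb R^{2\times2}$, $a_r:\Omega_r\to\mathbb R^2$ ($r\in\{\mathrm S,\mathrm B\}$), $q_D:\Omega_{\mathrm D}\to\mathbb R^2$, $p_D:\Omega_{\mathrm D}\to\mathbb R$; smooth means smooth up to the boundary of each region. Data: $f_{\mathrm S},f_{\mathrm B},f_D,g_{\mathrm S},g_{\mathrm B},g_D,h_{BD}$ (smooth). $(\nabla u)_{ij}=\partial_ju_i$ and $(\nabla\cdot\sigma)_i=\partial_x\sigma_{ix}+\partial_y\sigma_{iy}$. Residuals, for $r\in\{\mathrm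 S,\mathrm B\}$: $\mathcal R_r^\sigma=\sigma_r-\mu_r\nabla u_r+p_rI$ (constitutive), $\mathcal R_r^c=\nabla\cdot u_r$, $\mathcal R_r^m=-\nabla\cdot\sigma_r+\chi_r\frac{\mu}{K_B}u_r-f_r$ (momentum), $\mathcal R_r^g=a_r-\nabla p_r$ and $\mathcal R_r^p=\nabla\cdot a_r-\nabla\cdot f_r$ (auxiliary); $\widetilde{\mathcal R}_{\mathrm S}^m=\mathcal R_{\mathrm S}^m$, $\widetilde{\mathcal R}_{\mathrm B}^m=\mathcal R_{\mathrm B}^m/(1+\mu/K_B)$; $\mathcal R_D^q=q_D+\frac{K_D}{\mu}\nabla p_D$, $\mathcal R_D^c=\nabla\cdot q_D-f_D$; interface residuals $\mathcal R_{SB}^u=u_{\mathrm S}-u_{\mathrm B}$, $\mathcal R_{SB}^t=\sigma_{\mathrm S}n-\sigma_{\mathrm B}n$ on $\Gamma_{\mathrm{SB}}$, $\mathcal R_{BD}^m=(u_{\mathrm B})_y-(q_D)_y$, $\mathcal R_{BD}^t=\sigma_{\mathrm B}n+\lambda_{\mathrm{BJS}}(u_{\mathrm B}\cdot t)t+p_Dn-h_{BD}$ on $\Gamma_{\mathrm{BD}}$, and $\widetilde{\mathcal R}_{BD}^t=\big(\frac1{1+\lambda_{\mathrm{BJS}}}tt^T+nn^T\big)\mathcal R_{BD}^t$; exterior residuals $\mathcal R_{\mathrm S}^{\mathrm{ext}}=u_{\mathrm S}-g_{\mathrm S}$, $\mathcal R_{\mathrm B}^{\mathrm{ext}}=u_{\mathrm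 B}-g_{\mathrm B}$, $\mathcal R_D^{\mathrm{ext}}=(p_D-g_D)/(\mu/K_D)$ on the respective $\Gamma_r^{\mathrm{ext}}$. An exact solution (with $a_r=\nabla p_r$) is a smooth state for which all of these residuals vanish. For $R:G\to\mathbb R^{m_R}$ put $\mathfrak M_G(R)=\frac1{m_R}\int_G|R|_2^2\,d\nu_G$, with $\nu_G$ normalized area measure on a region, normalized arclength on an interface, and a prescribed convex combination of normalized edgewise arclength measures on an exterior boundary portion (matrices are vectors of entries). The functional is $$\mathcal J(z)=\sum_{r\in\{\mathrm S,\mathrm B\}}\big[\mathfrak M_{\Omega_r}(\mathcal R_r^\sigma)+\mathfrak M_{\Omega_r}(\widetilde{\mathcal R}_r^m)+\mathfrak M_{\Omega_r}(\mathcal R_r^c)+\mathfrak M_{\Omega_r}(\mathcal R_r^g)+\mathfrak M_{\Omega_r}(\mathcal R_r^p)\big]+\mathfrak M_{\Omega_{\mathrm D}}(\mathcal R_D^q)+\mathfrak M_{\Omega_{\mathrm D}}(\mathcal R_D^c)$$ $$\qquad+\mathfrak M_{\Gamma_{\mathrm{SB}}}(\mathcal R_{SB}^t)+\mathfrak M_{\Gamma_{\mathrm{BD}}}(\widetilde{\mathcal R}_{BD}^t)+\mathfrak M_{\Gamma_{\mathrm S}^{\mathrm{ext}}}(\mathcal R_{\mathrm S}^{\mathrm{ext}})+\mathfrak M_{\Gamma_{\mathrm B}^{\mathrm{ext}}}(\mathcal R_{\mathrm B}^{\mathrm{ext}})+\mathfrak M_{\Gamma_{\mathrm D}^{\mathrm{ext}}}(\mathcal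 R_D^{\mathrm{ext}}).$$ The physical moment is $$M_B(z)=\big\langle-(\nabla\cdot\sigma_{\mathrm B})_y-f_{\mathrm B,y}\big\rangle_{\Omega_{\mathrm B}}+\frac{\mu}{K_B}\bar u_{B,y}^{\mathrm{bc}},$$ where $\langle\cdot\rangle_{\Omega_{\mathrm B}}$ is the area average over $\Omega_{\mathrm B}$ and $\bar u_{B,y}^{\mathrm{bc}}$ is a fixed real number determined by the prescribed top and side velocity data only (independent of $z$). *)

(* Defs.v *)
From HB Require Import structures.
From mathcomp Require Import all_boot all_order all_algebra.
From mathcomp Require Import all_classical all_reals all_analysis.
Set Implicit Arguments.
Unset Strict Implicit.
Unset Printing Implicit Defensive.
Import Order.TTheory GRing.Theory Num.Theory.
Import numFieldNormedType.Exports.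
Local Open Scope classical_set_scope.
Local Open Scope ring_scope.

(** A field on an open region [D] of the plane is a total function on [R * R]
    of which only the values on [D] matter: boundary values are taken as
    limits from inside [D]. Vectors are columns; index [0] is x, [1] is y. *)

Section Calculus.
Context {R : realType}.
Implicit Types (D : set (R * R)) (f : R * R -> R) (x : R * R).

Definition axis (j : 'I_2) : R * R := if j == 0 then (1, 0) else (0, 1).

Definition partial (j : 'I_2) f x : R := 'D_(axis j) f x.

(** [Ck k D f]: the partial derivatives of [f] of order at most [k] exist
    in [D] and extend continuously to the closure of [D]. *)
Fixpoint Ck (k : nat) D f : Prop :=
  (forall x, closure D x -> cvg (f y @[y --> within D (nbhs x)])) /\
  match k with
  | 0%N => True
  | k'.+1 => forall j : 'I_2,
      (forall x, D x -> derivable f x (axis j)) /\ Ck k' D (partial j f)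
  end.

Definition smooth D f : Prop := forall k, Ck k D f.

Definition msmooth m n D (F : R * R -> 'M[R]_(m, n)) : Prop :=
  forall i j, smooth D (fun x => F x i j).

(** Smoothness of boundary data: restriction of a smooth function on the
    plane. *)
Definition smooth_on (G : set (R * R)) f : Prop :=
  exists2 f', smooth setT f' & {in G, f =1 f'}.

Definition msmooth_on m n (G : set (R * R)) (F : R * R -> 'M[R]_(m, n)) : Prop :=
  forall i j, smooth_on G (fun x => F x i j).

Definition trace D f x : R := lim (f y @[y --> within D (nbhs x)]).

Definition mtrace m n D (F : R * R -> 'M[R]_(m, n)) x : 'M[R]_(m, n) :=
  \matrix_(i, j) trace D (fun y => F y i j) x.

Definition sgrad f x : 'cV[R]_2 := \col_i partial i f x.

Definition vgrad (u : R * R -> 'cV[R]_2) x : 'M[R]_2 :=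
  \matrix_(i, j) partial j (fun y => u y i 0) x.

Definition vdiv (u : R * R -> 'cV[R]_2) x : R :=
  \sum_j partial j (fun y => u y j 0) x.

Definition mdiv (s : R * R -> 'M[R]_2) x : 'cV[R]_2 :=
  \col_i \sum_j partial j (fun y => s y i j) x.

Definition bdry D : set (R * R) := closure D `\` interior D.

Definition dot (v w : 'cV[R]_2) : R := \sum_i v i 0 * w i 0.

End Calculus.

Section MeanSquares.
Context {R : realType}.

Definition area := (@lebesgue_measure R \x @lebesgue_measure R)%E.

Definition avg_area (D : set (R * R)) (f : R * R -> R) : R :=
  (\int[area]_(x in D) f x) / fine (area D).

Definition seg_pt (e : (R * R) * (R * R)) (s : R) : R * R :=
  ((1 - s) * e.1.1 + s * e.2.1, (1 - s) * e.1.2 + s * e.2.2).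

(** Average for normalized arclength on the segment with endpoints [e.1],
    [e.2]. *)
Definition avg_seg (e : (R * R) * (R * R)) (f : R * R -> R) : R :=
  \int[@lebesgue_measure R]_(s in `]0, 1[) f (seg_pt e s).

Definition avg_edges n (es : n.-tuple ((R * R) * (R * R))) (w : 'I_n -> R)
    (f : R * R -> R) : R :=
  \sum_i w i * avg_seg (tnth es i) f.

Definition convex_weights n (w : 'I_n -> R) : Prop :=
  (forall i, 0 <= w i) /\ \sum_i w i = 1.

(** [avg] is one of the averages above; the number of components of the
    residual [F] is [m * n]. *)
Definition meansq m n (avg : (R * R -> R) -> R) (F : R * R -> 'M[R]_(m, n)) : R :=
  (m * n)%:R^-1 * avg (fun x => \sum_i \sum_j F x i j ^+ 2).

End MeanSquares.

Variant flow := Stokes | Brinkman.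

Section Geometry.
Context {R : realType}.

Definition yBD : R := 9 / 10.
Definition ySB : R := 11 / 10.
Definition hB : R := ySB - yBD.

Definition Omega : set (R * R) := `]0, 1[ `*` `]0, 2[.
Definition OmegaD : set (R * R) := `]0, 1[ `*` `]0, yBD[.
Definition Om (r : flow) : set (R * R) :=
  match r with
  | Stokes => `]0, 1[ `*` `]ySB, 2[
  | Brinkman => `]0, 1[ `*` `]yBD, ySB[
  end.

Definition GammaSB : set (R * R) := `]0, 1[ `*` [set ySB].
Definition GammaBD : set (R * R) := `]0, 1[ `*` [set yBD].
Definition Gext (r : flow) : set (R * R) := bdry (Om r) `&` bdry Omega.
Definition GextD : set (R * R) := bdry OmegaD `&` bdry Omega.

Definition segSB : (R * R) * (R * R) := ((0, ySB), (1, ySB)).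
Definition segBD : (R * R) * (R * R) := ((0, yBD), (1, yBD)).
Definition edgesS : 3.-tuple ((R * R) * (R * R)) :=
  [tuple ((0, 2), (1, 2)); ((0, ySB), (0, 2)); ((1, ySB), (1, 2))].
Definition edgesB : 2.-tuple ((R * R) * (R * R)) :=
  [tuple ((0, yBD), (0, ySB)); ((1, yBD), (1, ySB))].
Definition edgesD : 3.-tuple ((R * R) * (R * R)) :=
  [tuple ((0, 0), (1, 0)); ((0, 0), (0, yBD)); ((1, 0), (1, yBD))].

Definition ex : 'cV[R]_2 := delta_mx 0 0.
Definition ey : 'cV[R]_2 := delta_mx 1 0.
Definition nvec : 'cV[R]_2 := - ey.
Definition tvec : 'cV[R]_2 := ex.

End Geometry.

Record params (R : realType) := Params {
  mu : R; mu_eff : R; K_B : R; K_D : R; alpha : R }.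

Record data (R : realType) := Data {
  d_f : flow -> R * R -> 'cV[R]_2;
  d_fD : R * R -> R;
  d_g : flow -> R * R -> 'cV[R]_2;
  d_gD : R * R -> R;
  d_hBD : R * R -> 'cV[R]_2 }.

Record state (R : realType) := State {
  s_u : flow -> R * R -> 'cV[R]_2;
  s_p : flow -> R * R -> R;
  s_sigma : flow -> R * R -> 'M[R]_2;
  s_a : flow -> R * R -> 'cV[R]_2;
  s_qD : R * R -> 'cV[R]_2;
  s_pD : R * R -> R }.

Section Problem.
Context {R : realType}.
Implicit Types (P : params R) (F : data R) (z : state R) (r : flow) (x : R * R).

Definition positive_params P : Prop :=
  [/\ 0 < mu P, 0 < mu_eff P, 0 < K_B P, 0 < K_D P & 0 < alpha P].

Definition smooth_data F : Prop :=
  [/\ forall r, msmooth (Om r) (d_f F r),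
      smooth OmegaD (d_fD F),
      forall r, msmooth_on (Gext r) (d_g F r),
      smooth_on GextD (d_gD F) &
      msmooth_on GammaBD (d_hBD F)].

Definition smooth_state z : Prop :=
  (forall r, [/\ msmooth (Om r) (s_u z r), smooth (Om r) (s_p z r),
                 msmooth (Om r) (s_sigma z r) & msmooth (Om r) (s_a z r)]) /\
  msmooth OmegaD (s_qD z) /\ smooth OmegaD (s_pD z).

Definition mu_ P r : R := match r with Stokes => mu P | Brinkman => mu_eff P end.
Definition chi r : R := match r with Stokes => 0 | Brinkman => 1 end.
Definition lambdaBJS P : R := alpha P * mu_eff P / Num.sqrt (K_D P).

Definition res_sigma P z r x : 'M[R]_2 :=
  s_sigma z r x - mu_ P r *: vgrad (s_u z r) x + s_p z r x *: 1%:M.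

Definition res_c z r x : R := vdiv (s_u z r) x.

Definition res_m P F z r x : 'cV[R]_2 :=
  - mdiv (s_sigma z r) x + (chi r * (mu P / K_B P)) *: s_u z r x - d_f F r x.

Definition wres_m P F z r x : 'cV[R]_2 :=
  match r with
  | Stokes => res_m P F z Stokes x
  | Brinkman => (1 + mu P / K_B P)^-1 *: res_m P F z Brinkman x
  end.

Definition res_g z r x : 'cV[R]_2 := s_a z r x - sgrad (s_p z r) x.

Definition res_p F z r x : R := vdiv (s_a z r) x - vdiv (d_f F r) x.

Definition res_Dq P z x : 'cV[R]_2 := s_qD z x + (K_D P / mu P) *: sgrad (s_pD z) x.

Definition res_Dc F z x : R := vdiv (s_qD z) x - d_fD F x.

Definition res_SBu z x : 'cV[R]_2 :=
  mtrace (Om Stokes) (s_u z Stokes) x - mtrace (Om Brinkman) (s_u z Brinkman) x.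

(** The traction residuals take the stress as an argument, so that they can
    be evaluated at the reconstructed stress as well as at [sigma]. *)
Definition jumpSB (s : flow -> R * R -> 'M[R]_2) x : 'cV[R]_2 :=
  mtrace (Om Stokes) (s Stokes) x *m nvec -
  mtrace (Om Brinkman) (s Brinkman) x *m nvec.

Definition tractionBD P F (s : flow -> R * R -> 'M[R]_2) z x : 'cV[R]_2 :=
  mtrace (Om Brinkman) (s Brinkman) x *m nvec +
  (lambdaBJS P * dot (mtrace (Om Brinkman) (s_u z Brinkman) x) tvec)
    *: tvec +
  trace OmegaD (s_pD z) x *: nvec - d_hBD F x.

Definition res_SBt z x : 'cV[R]_2 := jumpSB (s_sigma z) x.

Definition res_BDm z x : R :=
  mtrace (Om Brinkman) (s_u z Brinkman) x 1 0 - mtrace OmegaD (s_qD z) x 1 0.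

Definition res_BDt P F z x : 'cV[R]_2 := tractionBD P F (s_sigma z) z x.

Definition wres_BDt P F z x : 'cV[R]_2 :=
  ((1 + lambdaBJS P)^-1 *: (tvec *m tvec^T) + nvec *m nvec^T)
    *m res_BDt P F z x.

Definition res_ext F z r x : 'cV[R]_2 := mtrace (Om r) (s_u z r) x - d_g F r x.

Definition res_extD P F z x : R :=
  (trace OmegaD (s_pD z) x - d_gD F x) / (mu P / K_D P).

Definition stress P z r x : 'M[R]_2 :=
  mu_ P r *: vgrad (s_u z r) x - s_p z r x *: 1%:M.

Definition exact_solution P F z : Prop :=
  [/\ smooth_state z,
      forall r x, Om r x ->
        [/\ res_sigma P z r x = 0, res_c z r x = 0, res_m P F z r x = 0,
            res_g z r x = 0 & res_p F z r x = 0],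
      forall x, OmegaD x -> res_Dq P z x = 0 /\ res_Dc F z x = 0,
      (forall x, GammaSB x -> res_SBu z x = 0 /\ res_SBt z x = 0) /\
      (forall x, GammaBD x -> res_BDm z x = 0 /\ res_BDt P F z x = 0) &
      (forall r x, Gext r x -> res_ext F z r x = 0) /\
      (forall x, GextD x -> res_extD P F z x = 0)].

Definition J_flow P F z r : R :=
  let M m n (res : R * R -> 'M[R]_(m, n)) := meansq (avg_area (Om r)) res in
  M _ _ (res_sigma P z r) + M _ _ (wres_m P F z r) +
  M _ _ (fun x => (res_c z r x)%:M : 'M[R]_1) + M _ _ (res_g z r) +
  M _ _ (fun x => (res_p F z r x)%:M : 'M[R]_1).

Definition J P F (wS : 'I_3 -> R) (wB : 'I_2 -> R) (wD : 'I_3 -> R) z : R :=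
  J_flow P F z Stokes + J_flow P F z Brinkman +
  meansq (avg_area OmegaD) (res_Dq P z) +
  meansq (avg_area OmegaD) (fun x => (res_Dc F z x)%:M : 'M[R]_1) +
  meansq (avg_seg segSB) (res_SBt z) +
  meansq (avg_seg segBD) (wres_BDt P F z) +
  meansq (avg_edges edgesS wS) (res_ext F z Stokes) +
  meansq (avg_edges edgesB wB) (res_ext F z Brinkman) +
  meansq (avg_edges edgesD wD) (fun x => (res_extD P F z x)%:M : 'M[R]_1).

(** [ubar] is the number computed from the top and side velocity data. *)
Definition moment P F (ubar : R) z : R :=
  avg_area (Om Brinkman)
    (fun x => - mdiv (s_sigma z Brinkman) x 1 0 - d_f F Brinkman x 1 0) +
  mu P / K_B P * ubar.

Definition dp (c : R) r x : R :=
  match r with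
  | Stokes => c * hB
  | Brinkman => c * (x.2 - yBD)
  end.

Definition da (c : R) r : 'cV[R]_2 :=
  match r with Stokes => 0 | Brinkman => c *: ey end.

Definition perturb (c : R) z : state R := {|
  s_u := s_u z;
  s_p := fun r x => s_p z r x + dp c r x;
  s_sigma := fun r x => s_sigma z r x + - dp c r x *: 1%:M;
  s_a := fun r x => s_a z r x + da c r;
  s_qD := s_qD z;
  s_pD := s_pD z |}.

End Problem.

(* Main.v *)
Require Import Defs.
From HB Require Import structures.
From mathcomp Require Import all_boot all_order all_algebra.
From mathcomp Require Import all_classical all_reals all_analysis.
From mathcomp Require Import ring lra.
Set Implicit Arguments.
Unset Strict Implicit.
Unset Printing Implicit Defensive.
Import Order.TTheory GRing.Theory Num.Theory.
Import numFieldNormedType.Exports.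
Local Open Scope classical_set_scope.
Local Open Scope ring_scope.

(** The pressure perturbation [dp] is affine in [y] on the Brinkman layer, zero
    at [yBD] and equal to the Stokes constant at [ySB]. Shifting the stress by
    [- dp I] and [a] by its gradient therefore cancels in the constitutive and
    auxiliary residuals and in both tractions, and survives only as
    [div (dp I) = c ey] in the Brinkman momentum balance. At an exact solution
    [J] reduces to the mean square of that constant. The shift of the moment
    needs additivity of the integral over the open layer: a function extending
    continuously to the closure is bounded and Borel, hence integrable. *)

(** * Closures, measurability and integrability on open rectangles *)

Section Plane.
Context {R : realType}.
Implicit Types (D U : set (R * R)) (f g : R * R -> R) (x : R * R).

(** A point below [b] is approached from the right and [b] itself from the left; in both cases the
    approaching points stay strictly inside. *)
Lemma closed_itv_sub_closure (a b : R) : a < b -> `[a, b] `<=` closure `]a, b[.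
Proof.
move=> ab x /=; rewrite in_itv/= => /andP[ax xb] B Bx.
have [xb'|bx] := ltP x b.
  have [y [By /andP[xy yb]]] : exists y, B y /\ x < y < b.
    apply: (@filter_ex _ x^'+); near=> y; split.
      by near: y; exact: (cvg_within _ Bx).
    by apply/andP; split; near: y; [exact: nbhs_right_gt|exact: nbhs_right_lt].
  by exists y; split => //=; rewrite in_itv/= yb (le_lt_trans ax).
have ax' : a < x by exact: lt_le_trans bx.
have [y [By /andP[ay yx]]] : exists y, B y /\ a < y < x.
  apply: (@filter_ex _ x^'-); near=> y; split.
    by near: y; exact: (cvg_within _ Bx).
  by apply/andP; split; near: y; [exact: nbhs_left_gt|exact: nbhs_left_lt].
by exists y; split => //=; rewrite in_itv/= ay (lt_le_trans yx).
Unshelve. all: by end_near. Qed.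

(** [Omega], [OmegaD] and both layers [Om r] unfold to instances of this set, so what is proved for
    it applies to them directly. *)
Definition rect (a b c d : R) : set (R * R) := `]a, b[ `*` `]c, d[.

Definition box (a b c d : R) : set (R * R) := `[a, b] `*` `[c, d].

Lemma open_rect a b c d : open (rect a b c d).
Proof.
have -> : rect a b c d = fst @^-1` `]a, b[ `&` snd @^-1` `]c, d[ by [].
apply: openI; apply: open_comp; try exact: interval_open.
- by move=> x _; exact: cvg_fst.
- by move=> x _; exact: cvg_snd.
Qed.

Lemma measurable_rect a b c d : measurable (rect a b c d).
Proof. by apply: measurableX; exact: measurable_itv. Qed.

Lemma compact_box a b c d : compact (box a b c d).
Proof. by apply: compact_setX; exact: segment_compact. Qed.

Lemma rect_sub_box a b c d : rect a b c d `<=` box a b c d.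
Proof. by move=> x [xab xcd]; split; exact: subset_itv_oo_cc. Qed.

Lemma box_sub_closure a b c d :
  a < b -> c < d -> box a b c d `<=` closure (rect a b c d).
Proof.
move=> ab cd [x y] [/= xab ycd] B [[B1 B2] /= [B1x B2y] B12].
have [s [abs B1s]] := closed_itv_sub_closure ab xab B1x.
have [t [cdt B2t]] := closed_itv_sub_closure cd ycd B2y.
by exists (s, t); split => //; exact: B12.
Qed.

Lemma area_rect a b c d : a < b -> c < d ->
  area (rect a b c d) = ((b - a) * (d - c))%:E.
Proof.
move=> ab cd; rewrite /area product_measure1E; [|exact: measurable_itv..].
have len (s t : R) : s < t -> lebesgue_measure `]s, t[%classic = (t - s)%:E.
  by move=> st; rewrite lebesgue_measure_itv/= lte_fin st EFinB.
by rewrite EFinM; congr (_ * _)%E; exact: len.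
Qed.

(** Measurability here refers to the product sigma-algebra, so [U] is written as a union of open
    rectangles with rational corners, of which there are countably many. *)
Lemma open_measurable_plane U : open U -> measurable U.
Proof.
move=> oU.
pose qrect (q : (rat * rat) * (rat * rat)) : set (R * R) :=
  rect (ratr q.1.1) (ratr q.1.2) (ratr q.2.1) (ratr q.2.2).
have -> : U = \bigcup_(q in [set q | qrect q `<=` U]) qrect q.
  apply/seteqP; split=> [[x y] Uxy|x [q /= qU]]; last exact: qU.
  have [e /= e0 eU] : exists2 e : R, 0 < e & ball (x, y) e `<=` U.
    by have /nbhs_ballP := open_nbhs_nbhs (conj oU Uxy).
  (* Balls of the product are taken coordinatewise, so rational endpoints within [e] on either side
     of each coordinate give a rectangle around the point inside the ball. *)
  have near_rat (t : R) : exists q : rat * rat,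
      [/\ t - e < ratr q.1, ratr q.1 < t, t < ratr q.2 & ratr q.2 < t + e].
    have [p] := @rat_in_itvoo R (t - e) t (ltac:(lra)).
    have [q] := @rat_in_itvoo R t (t + e) (ltac:(lra)).
    by rewrite !in_itv/= => /andP[? ?] /andP[? ?]; exists (p, q).
  have [p [p1 p2 p3 p4]] := near_rat x; have [q [q1 q2 q3 q4]] := near_rat y.
  exists (p, q); last by split; rewrite /= in_itv/=; apply/andP.
  move=> [s t] [/=]; rewrite !in_itv/= => /andP[? ?] /andP[? ?]; apply: eU.
  by split; rewrite /ball/= ltr_distlC; apply/andP; split; lra.
rewrite bigcup_mkcond; apply: countable_bigcupT_measurable => // q.
by case: ifP => _ //; exact: measurable_rect.
Qed.

(** Bounded open intervals generate the Borel sets of the line; their preimages are relatively open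
    in [D], that is, traces on [D] of open sets of the plane. *)
Lemma open_continuous_measurable_plane D f :
  open D -> {in D, continuous f} -> measurable_fun D f.
Proof.
move=> oD; rewrite -(continuous_open_subspace f oD) => /continuousP cf.
apply: (measurability _ (measurable_realfun.RGenOpens.measurableE R)).
move=> _ [_ [a [b ->] <-]].
have oab := @interval_open R (BRight a) (BLeft b) isT isT.
have /open_subspaceP[V oV VD] := cf _ oab.
by rewrite setIC -VD; apply: measurableI; exact: open_measurable_plane.
Qed.


(** The order-zero clause of [Ck], isolated because traces and integrals rely on it alone and it is
    stable under sums and scalar multiples. *)
Definition extends_cont D f : Prop :=
  forall x, closure D x -> cvg (f y @[y --> within D (nbhs x)]).

Lemma extends_cont_continuous D f :
  open D -> extends_cont D f -> {in D, continuous f}.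
Proof.
move=> oD cf x; rewrite inE => Dx.
have := cf _ (subset_closure Dx).
rewrite within_interior; last by rewrite (interior_id D).1.
move=> /cvg_ex[l fl].
(* The neighbourhood filter is not punctured, so [x] itself lies in every neighbourhood and [f x] is
   within every [e] of the limit. *)
suff flE : f x = l by rewrite /continuous_at flE.
apply/eqP; rewrite -subr_eq0 -normr_le0; apply/ler_addgt0Pl => e e0.
rewrite addr0 distrC; apply: ltW.
exact: (nbhs_singleton ((cvgrPdist_lt _ _).1 fl _ e0)).
Qed.

Lemma integrable_rect a b c d f : a < b -> c < d ->
  extends_cont (rect a b c d) f -> area.-integrable (rect a b c d) (EFin \o f).
Proof.
move=> ab cd cf; apply: measurable_bounded_integrable.
- exact: measurable_rect.
- by have := ltry ((b - a) * (d - c)); rewrite -area_rect.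
- apply: open_continuous_measurable_plane; first exact: open_rect.
  by apply: extends_cont_continuous => //; exact: open_rect.
(* The limit [l] at a point of the closed box bounds [f] by [1 + |l|] on the nearby part of the open
   rectangle; compactness of the box makes the bound uniform. *)
have : \forall M \near +oo,
    box a b c d `<=` [set x | rect a b c d x -> `|f x| <= M].
  have /compact_near_coveringP := @compact_box a b c d.
  apply=> x /(box_sub_closure ab cd)/cf/cvg_ex[l fl].
  have := (cvgrPdist_lt _ _).1 fl _ ltr01; rewrite near_withinE => fl1.
  near=> y M => /= Dy.
  have : `|l - f y| < 1 by move: Dy; near: y; exact: fl1.
  rewrite distrC => /ltW /(le_trans (lerB_dist _ _)).
  rewrite lerBlDr => /le_trans; apply.
  by near: M; exact: nbhs_pinfty_ge.
apply: filter_app; near=> M => fM x Dx /=.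
by apply: fM => //; exact: rect_sub_box.
Unshelve. all: by end_near. Qed.

End Plane.

(** * Boundary values as limits from inside a region *)

Section Traces.
Context {R : realType}.
Implicit Types (D : set (R * R)) (f g : R * R -> R) (x : R * R).

Lemma extends_contD D f g : extends_cont D f -> extends_cont D g ->
  extends_cont D (fun y => f y + g y).
Proof. by move=> cf cg x Dx; apply: is_cvgD; [exact: cf|exact: cg]. Qed.

Lemma extends_contM D f (k : R) : extends_cont D f ->
  extends_cont D (fun y => k * f y).
Proof. by move=> cf x Dx; apply: is_cvgM; [exact: is_cvg_cst|exact: cf]. Qed.

Lemma smooth_extends_cont D f : smooth D f -> extends_cont D f.
Proof. by move=> /(_ 0%N)[]. Qed.

Lemma smooth_extends_cont_partial D f j : smooth D f ->
  extends_cont D (partial j f).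
Proof. by move=> /(_ 1%N)[_ /(_ j)[_ []]]. Qed.

Lemma smooth_derivable D f j x : smooth D f -> D x -> derivable f x (axis j).
Proof. by move=> /(_ 1%N)[_ /(_ j)[df _]] /df. Qed.

(** At a point of the closure the within-filter is proper, so limits are unique and [lim] is
    additive. *)
Lemma traceD D f g x : extends_cont D f -> extends_cont D g -> closure D x ->
  trace D (fun y => f y + g y) x = trace D f x + trace D g x.
Proof.
move=> cf cg Dx; have := within_nbhs_proper (inferP Dx) => FD.
by apply: limD; [exact: cf|exact: cg].
Qed.

Lemma trace_continuous D g x : {for x, continuous g} -> closure D x ->
  trace D g x = g x.
Proof.
move=> cg Dx; have := within_nbhs_proper (inferP Dx) => FD.
by apply: norm_cvg_lim; exact: cvg_within_filter.
Qed.

Lemma continuous_extends_cont D g : continuous g -> extends_cont D g.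
Proof.
move=> cg x _; apply/cvg_ex; exists (g x); exact: cvg_within_filter (cg x).
Qed.

(** Since [h] is continuous on the whole plane, its trace is its value, whichever side it is taken
    from. The lemma serves for stress shifts with [h] equal to [- dp c r]. *)
Lemma mtrace_addZ m n D (s : R * R -> 'M[R]_(m, n)) (h : R * R -> R)
    (M : 'M[R]_(m, n)) x :
  (forall i j, extends_cont D (fun y => s y i j)) -> continuous h ->
  closure D x ->
  mtrace D (fun y => s y + h y *: M) x = mtrace D s x + h x *: M.
Proof.
move=> cs ch Dx; apply/matrixP => i j; rewrite !mxE.
have chM : continuous (fun y => h y * M i j).
  by move=> y; apply: cvgM; [exact: ch|exact: cvg_cst].
rewrite -(trace_continuous (chM x) Dx) -traceD//.
- by congr (trace _ _ _); apply/funext => y; rewrite !mxE.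
- exact: continuous_extends_cont.
Qed.

End Traces.

(** * Effect of the pressure shift on derivatives and tractions *)

Section Pressure.
Context {R : realType}.
Implicit Types (c : R) (r : flow) (x : R * R) (j : 'I_2).

Lemma yBD_lt_ySB : yBD < ySB :> R.
Proof. by rewrite /yBD /ySB; lra. Qed.

(** Linearity in [c] lets each entry of the matrix [dp I] be treated as a [dp] with its own
    constant. *)
Lemma dp_scale c k r x : dp c r x * k = dp (c * k) r x.
Proof. by case: r => /=; ring. Qed.

Lemma continuous_dp c r : continuous (dp c r).
Proof.
case: r => x /=; first exact: cvg_cst.
by apply: cvgM; [exact: cvg_cst|apply: cvgB; [exact: cvg_snd|exact: cvg_cst]].
Qed.

Lemma is_derive_dp c r x j : is_derive x (axis j) (dp c r) (da c r j 0).
Proof.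
case: r; first by rewrite /= mxE; exact: is_derive_cst.
(* In the Brinkman layer [dp] is affine, so the difference quotient already equals the derivative
   for every nonzero [h]. *)
have quot : \forall h \near (0 : R)^',
    h^-1 *: ((dp c Brinkman \o shift x) (h *: axis j) - dp c Brinkman x) =
    da c Brinkman j 0.
  near=> h; have h0 : h != 0 by near: h; exact: nbhs_dnbhs_neq.
  rewrite /= !mxE eqxx andbT /axis /GRing.scale/=.
  case: j => [[|[|//]] jlt]; rewrite -!val_eqE /= /GRing.scale/=.
    by field.
  by field.
apply: DeriveDef.
  exact: is_cvg_near_cst quot.
exact: norm_lim_near_cst quot.
Unshelve. all: by end_near. Qed.

Lemma partialD j f g x d : derivable f x (axis j) ->
  is_derive x (axis j) g d ->
  partial j (fun y => f y + g y : R) x = partial j f x + d.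
Proof. by move=> df [dg <-]; rewrite /partial -(deriveD df dg). Qed.

Lemma sgrad_dp c r (p : R * R -> R) x :
  (forall j, derivable p x (axis j)) ->
  sgrad (fun y => p y + dp c r y) x = sgrad p x + da c r.
Proof.
move=> dp; apply/colP => i; rewrite !mxE.
by rewrite (partialD (dp i) (is_derive_dp c r x i)).
Qed.

Lemma vdiv_add_cst (a : R * R -> 'cV[R]_2) (v : 'cV[R]_2) x :
  (forall j, derivable (fun y => a y j 0) x (axis j)) ->
  vdiv (fun y => a y + v) x = vdiv a x.
Proof.
move=> da; apply: eq_bigr => j _.
rewrite -[RHS]addr0 -(partialD (da j) (is_derive_cst (v j 0) x (axis j))).
by congr (partial _ _ _); apply/funext => y; rewrite mxE.
Qed.

(** The shift of entry [(i, j)] is a [dp] whose constant is [-c] on the diagonal and [0] off it, so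
    row [i] of the divergence retains only the derivative in direction [i]. *)
Lemma mdiv_sub_dp c r (s : R * R -> 'M[R]_2) x :
  (forall i j, derivable (fun y => s y i j) x (axis j)) ->
  mdiv (fun y => s y + - dp c r y *: 1%:M) x = mdiv s x - da c r.
Proof.
move=> ds; apply/colP => i; rewrite !mxE.
transitivity (\sum_j (partial j (fun y => s y i j) x
                      + da (- (c * (i == j)%:R)) r j 0)).
  apply: eq_bigr => j _; rewrite -(partialD (ds i j) (is_derive_dp _ r x j)).
  congr (partial _ _ _); apply/funext => y; rewrite !mxE.
  by rewrite mulNr dp_scale; case: (r) => /=; ring.
rewrite big_split/=; congr (_ + _); rewrite (bigD1 i)//= big1.
  by rewrite eqxx; case: (r); rewrite /= !mxE; ring.
move=> j ji; rewrite eq_sym (negbTE ji).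
by case: (r); rewrite /= !mxE; ring.
Qed.

Lemma GammaSB_closure r (x : R * R) : GammaSB x -> closure (Om r) x.
Proof.
case: x => x y [/= + ->]; rewrite in_itv/= => /andP[x0 x1].
by case: r; apply: box_sub_closure; rewrite /ySB /yBD; try lra;
  split; rewrite /= in_itv/=; apply/andP; split; lra.
Qed.

Lemma GammaBD_closure (x : R * R) : GammaBD x -> closure (Om Brinkman) x.
Proof.
case: x => x y [/= + ->]; rewrite in_itv/= => /andP[x0 x1].
by apply: box_sub_closure; rewrite /ySB /yBD; try lra;
  split; rewrite /= in_itv/=; apply/andP; split; lra.
Qed.

(** At height [ySB] the Brinkman shift [c * (ySB - yBD)] equals the Stokes constant [c * hB], so the
    two contributions cancel in the jump. *)
Lemma jumpSB_sub_dp c (s : flow -> R * R -> 'M[R]_2) x :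
  (forall r i j, extends_cont (Om r) (fun y => s r y i j)) -> GammaSB x ->
  jumpSB (fun r y => s r y + - dp c r y *: 1%:M) x = jumpSB s x.
Proof.
move=> cs Gx; have cdp r : continuous (fun y => - dp c r y).
  by move=> y; apply: cvgN; exact: continuous_dp.
rewrite /jumpSB !mtrace_addZ//; try exact: GammaSB_closure.
case: Gx => _ /= ->.
by rewrite -/hB !mulmxDl opprD addrACA subrr addr0.
Qed.

(** The Brinkman shift vanishes at height [yBD], while velocity and Darcy pressure are untouched. *)
Lemma tractionBD_sub_dp P F c (s : flow -> R * R -> 'M[R]_2) z x :
  (forall i j, extends_cont (Om Brinkman) (fun y => s Brinkman y i j)) ->
  GammaBD x ->
  tractionBD P F (fun r y => s r y + - dp c r y *: 1%:M) (perturb c z) x =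
  tractionBD P F s z x.
Proof.
move=> cs Gx; have cdp r : continuous (fun y => - dp c r y).
  by move=> y; apply: cvgN; exact: continuous_dp.
rewrite /tractionBD !mtrace_addZ//; last exact: GammaBD_closure.
by case: Gx => _ /= ->; rewrite subrr mulr0 oppr0 scale0r addr0.
Qed.

(** The reconstructed stress moves exactly as [s_sigma] does, so both traction lemmas above cover it
    as well. *)
Lemma stress_perturb P c (z : state R) :
  stress P (perturb c z) = fun r y => stress P z r y + - dp c r y *: 1%:M.
Proof.
apply/funext => r; apply/funext => y.
by rewrite /stress/= scalerDl opprD addrA scaleNr.
Qed.

Lemma extends_cont_stress P (z : state R) r i j : smooth_state z ->
  extends_cont (Om r) (fun y => stress P z r y i j).
Proof.
move=> [/(_ r)[su sp _ _] _].
have -> : (fun y => stress P z r y i j) = (fun y =>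
    mu_ P r * partial j (fun y => s_u z r y i 0) y
    + - (i == j)%:R * s_p z r y).
  by apply/funext => y; rewrite !mxE; ring.
apply: extends_contD; apply: extends_contM.
- exact: smooth_extends_cont_partial.
- exact: smooth_extends_cont.
Qed.

End Pressure.

(** * Averages of constants, vanishing mean squares, and the edges of the exterior boundary *)

Section Averages.
Context {R : realType}.
Implicit Types (D : set (R * R)) (f : R * R -> R) (a b c d : R).

Lemma avg_area_cst a b c d f k : a < b -> c < d ->
  {in rect a b c d, forall x, f x = k} -> avg_area (rect a b c d) f = k.
Proof.
move=> ab cd fk.
have -> : avg_area (rect a b c d) f = avg_area (rect a b c d) (fun=> k).
  by congr (_ / _); exact: eq_Rintegral.
have := @Rintegral_cst _ _ _ area _ (measurable_rect a b c d) k.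
rewrite /avg_area => ->.
have area0 : fine (area (rect a b c d)) != 0.
  by rewrite area_rect//= mulf_neq0// subr_eq0 gt_eqF.
exact: mulfK area0 k.
Qed.

(** Additivity of the integral requires both summands integrable; continuous extension to the closed
    rectangle supplies this for [f] and for the constant. *)
Lemma avg_areaD_cst a b c d f k : a < b -> c < d ->
  extends_cont (rect a b c d) f ->
  avg_area (rect a b c d) (fun x => f x + k) = avg_area (rect a b c d) f + k.
Proof.
move=> ab cd cf.
have ck : extends_cont (rect a b c d) (fun=> k).
  by apply: continuous_extends_cont => x; exact: cvg_cst.
have kE : avg_area (rect a b c d) (fun=> k) = k by exact: avg_area_cst.
rewrite -[in RHS]kE /avg_area -mulrDl; congr (_ / _).
by apply: RintegralD;
  [exact: measurable_rect|exact: integrable_rect|exact: integrable_rect].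
Qed.

Lemma avg_area_eq0 D f : {in D, forall x, f x = 0} -> avg_area D f = 0.
Proof.
move=> f0; have -> : avg_area D f = avg_area D (fun=> 0).
  by congr (_ / _); exact: eq_Rintegral.
by rewrite /avg_area /Rintegral integral0 mul0r.
Qed.

Lemma avg_seg_eq0 (e : (R * R) * (R * R)) f :
  (forall s, 0 < s < 1 -> f (seg_pt e s) = 0) -> avg_seg e f = 0.
Proof.
move=> f0; have -> : avg_seg e f = avg_seg e (fun=> 0).
  by apply: eq_Rintegral => s; rewrite inE/= in_itv/= => /f0.
by rewrite /avg_seg /Rintegral integral0.
Qed.

Lemma avg_edges_eq0 n (es : n.-tuple ((R * R) * (R * R))) w f :
  (forall i s, 0 < s < 1 -> f (seg_pt (tnth es i) s) = 0) ->
  avg_edges es w f = 0.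
Proof.
by move=> f0; apply: big1 => i _; rewrite avg_seg_eq0 ?mulr0// => s /f0.
Qed.

Lemma sumsq_mx0 m n (M : 'M[R]_(m, n)) : M = 0 -> \sum_i \sum_j M i j ^+ 2 = 0.
Proof.
by move=> ->; apply: big1 => i _; apply: big1 => j _; rewrite mxE expr0n.
Qed.

Lemma meansq_area_eq0 m n D (F : R * R -> 'M[R]_(m, n)) :
  {in D, forall x, F x = 0} -> meansq (avg_area D) F = 0.
Proof.
by move=> F0; rewrite /meansq avg_area_eq0 ?mulr0// => x /F0; exact: sumsq_mx0.
Qed.

Lemma meansq_seg_eq0 m n (e : (R * R) * (R * R)) (F : R * R -> 'M[R]_(m, n)) :
  (forall s, 0 < s < 1 -> F (seg_pt e s) = 0) -> meansq (avg_seg e) F = 0.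
Proof.
by move=> F0; rewrite /meansq avg_seg_eq0 ?mulr0// => x /F0; exact: sumsq_mx0.
Qed.

Lemma meansq_edges_eq0 m n k (es : k.-tuple ((R * R) * (R * R))) w
    (F : R * R -> 'M[R]_(m, n)) :
  (forall i s, 0 < s < 1 -> F (seg_pt (tnth es i) s) = 0) ->
  meansq (avg_edges es w) F = 0.
Proof.
move=> F0; rewrite /meansq avg_edges_eq0 ?mulr0// => i s /(F0 i).
exact: sumsq_mx0.
Qed.

Lemma bdry_rect a b c d (x : R * R) : a < b -> c < d ->
  box a b c d x -> ~ rect a b c d x -> bdry (rect a b c d) x.
Proof.
move=> ab cd xbox xrect; split; first exact: box_sub_closure.
by move=> /interior_subset.
Qed.

Lemma segSB_GammaSB (s : R) : 0 < s < 1 -> GammaSB (seg_pt segSB s).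
Proof.
move=> /andP[s0 s1]; split=> /=; last by ring.
by rewrite in_itv/=; apply/andP; split; lra.
Qed.

Lemma segBD_GammaBD (s : R) : 0 < s < 1 -> GammaBD (seg_pt segBD s).
Proof.
move=> /andP[s0 s1]; split=> /=; last by ring.
by rewrite in_itv/=; apply/andP; split; lra.
Qed.

(** Case analysis on the edge index; an interior point of the edge lies in the closed box but
    outside the open rectangle, both for the region and for [Omega]. The pair of origins is only the
    default value of [nth]. *)
Ltac solve_edge :=
  move=> [[|[|[|//]]] ?] s /andP[s0 s1]//;
  rewrite (tnth_nth ((0, 0), (0, 0)))/=;
  split; (apply: bdry_rect; rewrite /ySB /yBD; [lra|lra|split|case]);
  rewrite /= !in_itv/= /ySB /yBD; try (move=> /andP[? ?] /andP[? ?]; lra);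
  apply/andP; split; lra.

Lemma edgesS_Gext (i : 'I_3) (s : R) : 0 < s < 1 ->
  Gext Stokes (seg_pt (tnth edgesS i) s).
Proof. move: i s; solve_edge. Qed.

Lemma edgesB_Gext (i : 'I_2) (s : R) : 0 < s < 1 ->
  Gext Brinkman (seg_pt (tnth edgesB i) s).
Proof. move: i s; solve_edge. Qed.

Lemma edgesD_GextD (i : 'I_3) (s : R) : 0 < s < 1 ->
  GextD (seg_pt (tnth edgesD i) s).
Proof. move: i s; solve_edge. Qed.

End Averages.

(** * Invariance of the residuals, shift of the moment, value of the functional *)

Section Residuals.
Context {R : realType}.
Context (P : params R) (F : data R) (c : R).
Implicit Types (z : state R) (r : flow) (x : R * R).

Lemma res_sigma_perturb z r x :
  res_sigma P (perturb c z) r x = res_sigma P z r x.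
Proof. by apply/matrixP => i j; rewrite !mxE/=; ring. Qed.

Lemma res_g_perturb z r x : smooth_state z -> Om r x ->
  res_g (perturb c z) r x = res_g z r x.
Proof.
move=> [/(_ r)[_ sp _ _] _] Dx; rewrite /res_g/= sgrad_dp.
  by rewrite opprD addrACA subrr addr0.
by move=> j; exact: smooth_derivable sp Dx.
Qed.

Lemma res_p_perturb z r x : smooth_state z -> Om r x ->
  res_p F (perturb c z) r x = res_p F z r x.
Proof.
move=> [/(_ r)[_ _ _ sa] _] Dx; rewrite /res_p/= vdiv_add_cst// => j.
exact: smooth_derivable (sa j 0) Dx.
Qed.

Lemma mdiv_sigma_perturb z r x : smooth_state z -> Om r x ->
  mdiv (s_sigma (perturb c z) r) x = mdiv (s_sigma z r) x - da c r.
Proof.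
move=> [/(_ r)[_ _ ss _] _] Dx; apply: mdiv_sub_dp => i j.
exact: smooth_derivable (ss i j) Dx.
Qed.

Lemma res_m_perturb z r x : smooth_state z -> Om r x ->
  res_m P F (perturb c z) r x = res_m P F z r x + da c r.
Proof.
move=> sz Dx; rewrite /res_m mdiv_sigma_perturb// opprB.
by rewrite [da c r - _]addrC -!addrA; congr (_ + _); rewrite addrC -!addrA.
Qed.

Lemma extends_cont_sigma z r i j : smooth_state z ->
  extends_cont (Om r) (fun y => s_sigma z r y i j).
Proof.
by move=> [/(_ r)[_ _ ss _] _]; exact: smooth_extends_cont.
Qed.

Lemma res_SBt_perturb z x : smooth_state z -> GammaSB x ->
  res_SBt (perturb c z) x = res_SBt z x.
Proof.
by move=> sz; apply: jumpSB_sub_dp => r i j; exact: extends_cont_sigma.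
Qed.

Lemma res_BDt_perturb z x : smooth_state z -> GammaBD x ->
  res_BDt P F (perturb c z) x = res_BDt P F z x.
Proof.
by move=> sz; apply: tractionBD_sub_dp => i j; exact: extends_cont_sigma.
Qed.

(** On the layer the y component of [- mdiv] gains exactly [c], whose average is [c]; the
    boundary-data term does not depend on the state. *)
Lemma moment_perturb ubar z : smooth_data F -> smooth_state z ->
  moment P F ubar (perturb c z) = moment P F ubar z + c.
Proof.
move=> [sf _ _ _ _] sz; rewrite /moment addrAC; congr (_ + _).
rewrite -avg_areaD_cst.
- congr (_ / _); apply: eq_Rintegral => x; rewrite inE => Dx.
  rewrite mdiv_sigma_perturb// !mxE eqxx/=; ring.
- exact: ltr01.
- exact: yBD_lt_ySB.
(* This form exhibits the integrand as a scalar multiple of a sum of two stress derivatives and a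
   force component, each extending continuously by smoothness. *)
have -> : (fun x => - mdiv (s_sigma z Brinkman) x 1 0 - d_f F Brinkman x 1 0) =
   (fun x => -1 * (partial 0 (fun y => s_sigma z Brinkman y 1 0) x +
      partial 1 (fun y => s_sigma z Brinkman y 1 1) x + d_f F Brinkman x 1 0)).
  apply/funext => x; rewrite !mxE big_ord_recl big_ord1.
  by rewrite (_ : lift ord0 ord0 = 1); [ring|exact/val_inj].
have [/(_ Brinkman)[_ _ ss _] _] := sz.
apply: extends_contM; apply: extends_contD; last first.
  exact: smooth_extends_cont (sf Brinkman 1 0).
by apply: extends_contD; exact: smooth_extends_cont_partial.
Qed.

Lemma J_perturb wS wB wD z : positive_params P -> exact_solution P F z ->
  J P F wS wB wD (perturb c z) = c ^+ 2 / (2 * (1 + mu P / K_B P) ^+ 2).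
Proof.
move=> hP [sz res0 resD0 [resSB0 resBD0] [ext0 extD0]].
have area0 r m n (G : R * R -> 'M[R]_(m, n)) :
    (forall x, Om r x -> G x = 0) -> meansq (avg_area (Om r)) G = 0.
  by move=> G0; apply: meansq_area_eq0 => x; rewrite inE => /G0.
have sigma0 r : meansq (avg_area (Om r)) (res_sigma P (perturb c z) r) = 0.
  by apply: area0 => x /res0[? _ _ _ _]; rewrite res_sigma_perturb.
have c0 r : meansq (avg_area (Om r))
    (fun x => (res_c (perturb c z) r x)%:M : 'M[R]_1) = 0.
  by apply: area0 => x /res0[_ + _ _ _]; rewrite /res_c/= => ->; exact: raddf0.
have g0 r : meansq (avg_area (Om r)) (res_g (perturb c z) r) = 0.
  by apply: area0 => x Dx; rewrite res_g_perturb//; case: (res0 _ _ Dx).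
have p0 r : meansq (avg_area (Om r))
    (fun x => (res_p F (perturb c z) r x)%:M : 'M[R]_1) = 0.
  apply: area0 => x Dx; rewrite res_p_perturb//.
  by case: (res0 _ _ Dx) => _ _ _ _ ->; exact: raddf0.
have mS0 : meansq (avg_area (Om Stokes)) (wres_m P F (perturb c z) Stokes) = 0.
  apply: area0 => x Dx; rewrite /wres_m res_m_perturb// addr0.
  by case: (res0 _ _ Dx).
have mB : meansq (avg_area (Om Brinkman)) (wres_m P F (perturb c z) Brinkman) =
    c ^+ 2 / (2 * (1 + mu P / K_B P) ^+ 2).
  (* The original residual is zero and [da] has only a y component, so the squared norm is this
     constant; the factor [1/2] comes from the two components of the residual. *)
  rewrite /meansq (@avg_area_cst _ 0 1 yBD ySB _
    ((c / (1 + mu P / K_B P)) ^+ 2)) ?ltr01 ?yBD_lt_ySB//.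
    by rewrite muln1 exprMn exprVn mulrCA -invfM.
  move=> x; rewrite inE => Dx.
  rewrite big_ord_recl big_ord1 !big_ord1 /wres_m res_m_perturb//.
  have [_ _ -> _ _] := res0 Brinkman _ Dx.
  by rewrite add0r !mxE/=; ring.
have Dq0 : meansq (avg_area OmegaD) (res_Dq P (perturb c z)) = 0.
  by apply: meansq_area_eq0 => x; rewrite inE => /resD0[].
have Dc0 : meansq (avg_area OmegaD)
    (fun x => (res_Dc F (perturb c z) x)%:M : 'M[R]_1) = 0.
  apply: meansq_area_eq0 => x; rewrite inE => /resD0[_].
  by rewrite /res_Dc/= => ->; exact: raddf0.
have SB0 : meansq (avg_seg segSB) (res_SBt (perturb c z)) = 0.
  apply: meansq_seg_eq0 => s /segSB_GammaSB Gs.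
  by rewrite res_SBt_perturb//; case: (resSB0 _ Gs).
have BD0 : meansq (avg_seg segBD) (wres_BDt P F (perturb c z)) = 0.
  apply: meansq_seg_eq0 => s /segBD_GammaBD Gs.
  by rewrite /wres_BDt res_BDt_perturb//; case: (resBD0 _ Gs) => _ ->; exact: mulmx0.
have eS0 : meansq (avg_edges edgesS wS) (res_ext F (perturb c z) Stokes) = 0.
  by apply: meansq_edges_eq0 => i s /(edgesS_Gext i)/ext0.
have eB0 : meansq (avg_edges edgesB wB) (res_ext F (perturb c z) Brinkman) = 0.
  by apply: meansq_edges_eq0 => i s /(edgesB_Gext i)/ext0.
have eD0 : meansq (avg_edges edgesD wD)
    (fun x => (res_extD P F (perturb c z) x)%:M : 'M[R]_1) = 0.
  apply: meansq_edges_eq0 => i s /(edgesD_GextD i)/extD0.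
  by rewrite /res_extD/= => ->; exact: raddf0.
(* The five-term shape of [J_flow] is kept so that each summand is matched by its own fact. *)
have JS0 : J_flow P F (perturb c z) Stokes = 0 + 0 + 0 + 0 + 0.
  by congr (_ + _ + _ + _ + _); [exact: sigma0|exact: mS0|exact: c0|exact: g0
                                |exact: p0].
have JB : J_flow P F (perturb c z) Brinkman =
    0 + c ^+ 2 / (2 * (1 + mu P / K_B P) ^+ 2) + 0 + 0 + 0.
  by congr (_ + _ + _ + _ + _); [exact: sigma0|exact: mB|exact: c0|exact: g0
                                |exact: p0].
by rewrite /J JS0 JB Dq0 Dc0 SB0 BD0 eS0 eB0 eD0 !addr0 !add0r.
Qed.

End Residuals.

(** * Assembly of the four claims from the pointwise identities *)

Theorem mainTheorem3 (R : realType) (P : params R) (F : data R)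
    (wS : 'I_3 -> R) (wB : 'I_2 -> R) (wD : 'I_3 -> R) (ubar c : R)
    (hP : positive_params P) (hF : smooth_data F)
    (hwS : convex_weights wS) (hwB : convex_weights wB)
    (hwD : convex_weights wD) :
  (* (i) *)
  (forall z : state R, smooth_state z ->
    let z' := perturb c z in
    (forall r : flow,
      [/\ {in Om r, res_sigma P z' r =1 res_sigma P z r},
          {in Om r, res_c z' r =1 res_c z r},
          {in Om r, res_g z' r =1 res_g z r},
          {in Om r, res_p F z' r =1 res_p F z r} &
          {in Gext r, res_ext F z' r =1 res_ext F z r}]) /\
    {in Om Stokes, res_m P F z' Stokes =1 res_m P F z Stokes} /\
    [/\ {in OmegaD, res_Dq P z' =1 res_Dq P z},
        {in OmegaD, res_Dc F z' =1 res_Dc F z} &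
        {in GextD, res_extD P F z' =1 res_extD P F z}] /\
    [/\ {in GammaSB, res_SBu z' =1 res_SBu z},
        {in GammaSB, res_SBt z' =1 res_SBt z},
        {in GammaBD, res_BDm z' =1 res_BDm z},
        {in GammaBD, res_BDt P F z' =1 res_BDt P F z} &
        {in GammaBD, wres_BDt P F z' =1 wres_BDt P F z}] /\
    {in Om Brinkman, forall x,
      res_m P F z' Brinkman x = res_m P F z Brinkman x + c *: ey}) /\
  (* (ii) *)
  (forall z : state R, exact_solution P F z ->
    J P F wS wB wD (perturb c z) = c ^+ 2 / (2 * (1 + mu P / K_B P) ^+ 2)) /\
  (* (iii) *)
  (forall z : state R, smooth_state z ->
    moment P F ubar (perturb c z) = moment P F ubar z + c) /\
  (* (iv) *)
  (forall z : state R, smooth_state z ->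
    let z' := perturb c z in
    [/\ {in GammaBD,
           tractionBD P F (s_sigma z') z' =1 tractionBD P F (s_sigma z) z},
        {in GammaSB, jumpSB (s_sigma z') =1 jumpSB (s_sigma z)},
        {in GammaBD,
           tractionBD P F (stress P z') z' =1 tractionBD P F (stress P z) z} &
        {in GammaSB, jumpSB (stress P z') =1 jumpSB (stress P z)}]).
Proof.
split; [|split; [|split]].
- move=> z sz; split; [|split; [|split; [|split]]].
  + move=> r; split=> // x; rewrite inE => Dx.
    * exact: res_sigma_perturb.
    * exact: res_g_perturb.
    * exact: res_p_perturb.
  + by move=> x; rewrite inE => Dx; rewrite res_m_perturb//= addr0.
  + by split.
  + split=> // x; rewrite inE => Gx.
    * exact: res_SBt_perturb.
    * exact: res_BDt_perturb.
    * by rewrite /wres_BDt res_BDt_perturb.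
  + by move=> x; rewrite inE => Dx; rewrite res_m_perturb.
- by move=> z; exact: J_perturb.
- by move=> z; exact: moment_perturb.
- move=> z sz; split=> x; rewrite inE => Gx.
  + exact: res_BDt_perturb.
  + exact: res_SBt_perturb.
  (* For the reconstructed stress, continuous extension comes from that of the velocity derivatives
     and the pressure. *)
  + rewrite stress_perturb; apply: tractionBD_sub_dp => // i j.
    exact: extends_cont_stress.
  + rewrite stress_perturb; apply: jumpSB_sub_dp => // r i j.
    exact: extends_cont_stress.
Qed.
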